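(* Let $p$ be a prime, let $n$ be a positive integer, let $r$ be a non-negative integer, and let $m_1,\ldots,m_{np}\in\{0,\ldots,np\}$ be such that $np=\sum_{i=1}^{np} i\,m_i$. Let $n^*=n/2$ if $n$ is even, and $n^*=n$ otherwise. Then: 1) If $\sum_{i\in\{1,\ldots,np\},\, i\notin\{1,p\}} m_i=0$, then $$c_{np}(m_1,\ldots,m_{np})\equiv (-1)^{p m_p}\binom{n}{m_p} \pmod{n^*p\,\mathbb{Z}_p}.$$ 2) If $\sum_{i\in\{1,\ldots,np\},\, i\notin\{1,p\}} m_i\neq 0$, then $$c_{np}(m_1,\ldots,m_{np})\equiv 0 \pmod{n^*p\,\mathbb{Z}_p}.$$ 3) The cycle indicator polynomials satisfy the congruence $$C_{r+np}\equiv (X_1^p-X_p)^n\, C_r \pmod{n^*p\,\mathbb{Z}_p[X_1,\ldots,X_{r+np}]}.$$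
   Context: $\mathbb{Z}_p$ denotes the ring of $p$-adic integers. For a positive integer $k$ and non-negative integers $m_1,\ldots,m_k$ with $\sum_{i=1}^k i\,m_i=k$, put $$c_k(m_1,\ldots,m_k)=\frac{k!}{\prod_{i=1}^k i^{m_i}\,(m_i!)},$$ which is an integer. The cycle indicator of the symmetric group $S_k$ is the polynomial $$C_k=C_k(X_1,\ldots,X_k)=\sum c_k(m_1,\ldots,m_k)\prod_{i=1}^k X_i^{m_i}\in\mathbb{Z}[X_1,\ldots,X_k],$$ where the sum is over all tuples of non-negative integers $(m_1,\ldots,m_k)$ with $\sum_{i=1}^k i\,m_i=k$. Also $C_0=1$. *)

(* Defs.v *)
From HB Require Import structures.
From mathcomp Require Import all_boot all_order all_algebra.
From mathcomp Require Import boolp mpoly.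

Set Implicit Arguments.
Unset Strict Implicit.
Unset Printing Implicit Defensive.

Import GRing.Theory.
Local Open Scope ring_scope.

(* Z_p as the inverse limit of the rings Z/p^(k+1), k >= 0.  Starting at
   exponent 1 avoids 'Z_1, which is Z/2 in MathComp.  For p < 2 the modulus
   'Z_(p ^ k.+1) is always 2, so only p >= 2 (in practice, p prime) is
   meaningful. *)
Definition Zpow_red (p k : nat) (x : 'Z_(p ^ k.+2)) : 'Z_(p ^ k.+1) := inZp x.

Record padic_int (p : nat) : Type := PadicInt {
  padic_proj : forall k, 'Z_(p ^ k.+1);
  padic_compat : forall k, Zpow_red (padic_proj k.+1) = padic_proj k }.

Section PadicRing.

Variable p : nat.
Implicit Types x y z : padic_int p.

Lemma padic_intP x y : (forall k, padic_proj x k = padic_proj y k) -> x = y.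
Proof.
case: x y => [f fP] [g gP] /= fg.
have efg : f = g by apply: functional_extensionality_dep.
by case: _ / efg gP {fg} => gP; rewrite (Prop_irrelevance fP gP).
Qed.

Lemma Zpow_dvd k : ((Zp_trunc (p ^ k.+1)).+2 %| (Zp_trunc (p ^ k.+2)).+2)%N.
Proof.
have [p_le1 | p_gt1] := leqP p 1; last first.
  by rewrite !Zp_cast -?[1%N](expn0 p) ?ltn_exp2l ?dvdn_exp2l.
by case: p p_le1 => [|[|//]] _; rewrite ?exp0n // !exp1n.
Qed.

Lemma Zpow_red1 k : Zpow_red (1 : 'Z_(p ^ k.+2)) = 1.
Proof. by apply: val_inj; rewrite /= modn_dvdm ?Zpow_dvd. Qed.

Lemma Zpow_redD k (a b : 'Z_(p ^ k.+2)) :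
  Zpow_red (a + b) = Zpow_red a + Zpow_red b.
Proof. by apply: val_inj; rewrite /= modn_dvdm ?Zpow_dvd // modnDm. Qed.

Lemma Zpow_redM k (a b : 'Z_(p ^ k.+2)) :
  Zpow_red (a * b) = Zpow_red a * Zpow_red b.
Proof. by apply: val_inj; rewrite /= modn_dvdm ?Zpow_dvd // modnMm. Qed.

Lemma Zpow_red0 k : Zpow_red (0 : 'Z_(p ^ k.+2)) = 0.
Proof. by apply: val_inj; rewrite /= mod0n. Qed.

Lemma Zpow_redN k (a : 'Z_(p ^ k.+2)) : Zpow_red (- a) = - Zpow_red a.
Proof. by apply/eqP; rewrite -addr_eq0 -Zpow_redD addNr Zpow_red0. Qed.

Definition padic_zero : padic_int p :=
  @PadicInt p (fun=> 0) (fun k => Zpow_red0 k).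
Definition padic_one : padic_int p :=
  @PadicInt p (fun=> 1) (fun k => Zpow_red1 k).

Lemma padic_opp_compat x k : Zpow_red (- padic_proj x k.+1) = - padic_proj x k.
Proof. by rewrite Zpow_redN padic_compat. Qed.
Definition padic_opp x : padic_int p :=
  @PadicInt p (fun k => - padic_proj x k) (padic_opp_compat x).

Lemma padic_add_compat x y k :
  Zpow_red (padic_proj x k.+1 + padic_proj y k.+1)
    = padic_proj x k + padic_proj y k.
Proof. by rewrite Zpow_redD !padic_compat. Qed.
Definition padic_add x y : padic_int p :=
  @PadicInt p (fun k => padic_proj x k + padic_proj y k) (padic_add_compat x y).

Lemma padic_mul_compat x y k :
  Zpow_red (padic_proj x k.+1 * padic_proj y k.+1)
    = padic_proj x k * padic_proj y k.
Proof. by rewrite Zpow_redM !padic_compat. Qed.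
Definition padic_mul x y : padic_int p :=
  @PadicInt p (fun k => padic_proj x k * padic_proj y k) (padic_mul_compat x y).

Lemma padic_addA : associative padic_add.
Proof. by move=> x y z; apply: padic_intP => k; exact: addrA. Qed.
Lemma padic_addC : commutative padic_add.
Proof. by move=> x y; apply: padic_intP => k; exact: addrC. Qed.
Lemma padic_add0 : left_id padic_zero padic_add.
Proof. by move=> x; apply: padic_intP => k; exact: add0r. Qed.
Lemma padic_addN : left_inverse padic_zero padic_opp padic_add.
Proof. by move=> x; apply: padic_intP => k; exact: addNr. Qed.

HB.instance Definition _ := gen_eqMixin (padic_int p).
HB.instance Definition _ := gen_choiceMixin (padic_int p).
HB.instance Definition _ := GRing.isZmodule.Build (padic_int p)
  padic_addA padic_addC padic_add0 padic_addN.

Lemma padic_mulA : associative padic_mul.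
Proof. by move=> x y z; apply: padic_intP => k; exact: mulrA. Qed.
Lemma padic_mulC : commutative padic_mul.
Proof. by move=> x y; apply: padic_intP => k; exact: mulrC. Qed.
Lemma padic_mul1 : left_id padic_one padic_mul.
Proof. by move=> x; apply: padic_intP => k; exact: mul1r. Qed.
Lemma padic_mulDl : left_distributive padic_mul padic_add.
Proof. by move=> x y z; apply: padic_intP => k; exact: mulrDl. Qed.
Lemma padic_oner_neq0 : padic_one != 0.
Proof.
apply/eqP => /(congr1 (fun x => padic_proj x 0)) /= /eqP.
by rewrite oner_eq0.
Qed.

HB.instance Definition _ := GRing.Zmodule_isComNzRing.Build (padic_int p)
  padic_mulA padic_mulC padic_mul1 padic_mulDl padic_oner_neq0.

End PadicRing.

(* x = y modulo the principal ideal a R. *)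
Definition congr_mod (R : comNzRingType) (a x y : R) : Prop :=
  exists z : R, x - y = a * z.

(* Tuples (m_1, ..., m_k) and variables X_1, ..., X_k are indexed by 'I_k:
   the ordinal i : 'I_k stands for the index i.+1. *)
Definition cycle_weight (k : nat) (m : 'I_k -> nat) : nat :=
  (\sum_(i < k) i.+1 * m i)%N.

Definition cycle_den (k : nat) (m : 'I_k -> nat) : nat :=
  (\prod_(i < k) (i.+1 ^ m i * (m i)`!))%N.

(* The division is exact when cycle_weight m = k, see cycle_den_dvd. *)
Definition cycle_coef (k : nat) (m : 'I_k -> nat) : nat :=
  (k`! %/ cycle_den m)%N.

Lemma expn_fact_dvd (i a : nat) : (i.+1 ^ a * a`! %| (i.+1 * a)`!)%N.
Proof.
elim: a => [|a IHa]; first by rewrite expn0 muln0.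
rewrite expnS factS mulnACA mulnS addSn factS dvdn_mul //.
apply: dvdn_trans IHa _; rewrite -(bin_fact (leq_addl i (i.+1 * a))).
by apply/dvdn_mull/dvdn_mulr.
Qed.

Lemma prod_fact_dvd (I : Type) (s : seq I) (f : I -> nat) :
  (\prod_(i <- s) (f i)`! %| (\sum_(i <- s) f i)`!)%N.
Proof.
elim: s => [|x s IHs]; first by rewrite !big_nil.
rewrite !big_cons -(bin_fact (leq_addr _ (f x))) addKn.
by apply: dvdn_mull; apply: dvdn_mul.
Qed.

Lemma cycle_den_dvd (k : nat) (m : 'I_k -> nat) :
  cycle_weight m = k -> (cycle_den m %| k`!)%N.
Proof.
move=> wm; have -> : (k`! = (cycle_weight m)`!)%N by rewrite wm.
apply: dvdn_trans (prod_fact_dvd _ _).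
by apply: (big_ind2 dvdn) => // [* | i _]; [exact: dvdn_mul | exact: expn_fact_dvd].
Qed.

(* Any m with cycle_weight m = k has all its entries <= k, so summing over
   'I_k.+1-valued functions loses nothing. *)
Definition cycle_indicator (k : nat) : {mpoly int[k]} :=
  \sum_(m : {ffun 'I_k -> 'I_k.+1} | cycle_weight (fun i => m i) == k)
     (cycle_coef (fun i => m i))%:R *: \prod_(i < k) 'X_i ^+ m i.

Lemma cycle_weight_le (k : nat) (m : 'I_k -> nat) (i : 'I_k) :
  cycle_weight m = k -> (m i <= k)%N.
Proof.
move=> wm; suff: (m i <= cycle_weight m)%N by rewrite wm.
rewrite /cycle_weight (bigD1 i) //=.
by apply: leq_trans (leq_addr _ _); rewrite leq_pmull.
Qed.

Lemma cycle_indicator0 : cycle_indicator 0 = 1.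
Proof.
rewrite /cycle_indicator (big_pred1 [ffun=> ord0]) => [|m]; last first.
  rewrite /cycle_weight big_ord0 eqxx /=; apply/esym/eqP/ffunP; by case.
by rewrite big_ord0 /cycle_coef /cycle_den big_ord0 divnn scale1r.
Qed.

(* C_k with coefficients in R, in R[X_1, ..., X_N] where k <= N. *)
Definition cycle_indicator_in (R : comNzRingType) (k N : nat) (le_kN : (k <= N)%N)
    : {mpoly R[N]} :=
  map_mpoly intr (cycle_indicator k) \mPo [tuple 'X_(widen_ord le_kN i) | i < k].

Definition nstar (n : nat) : nat := if odd n then n else n./2.

(* Main.v *)
From HB Require Import structures.
Require Import Defs.
From mathcomp Require Import all_boot all_order all_algebra.
From mathcomp Require Import mpoly.
From mathcomp Require Import zify ring.

Set Implicit Arguments.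
Unset Strict Implicit.
Unset Printing Implicit Defensive.

Import GRing.Theory.
Local Open Scope ring_scope.

(** The exponential generating function F(t) = sum_k C_k t^k / k! satisfies
    F' = f F with f = sum_i X_(i+1) t^i.  With L g = g' + f g ([twist] below) one
    has (g F)' = (L g) F, so that C_k is the constant term of L^k 1.  With
    finitely many variables f is a polynomial in t, so that neither denominators
    nor power series occur.

    Let a = X_1^p - X_p.  As a does not involve t, it commutes with the operator
    T = L^p - a ([twist_defect]), and
      C_(r+np) = sum_j bin(n, j) a^(n-j) (L^r T^j 1)(0).
    The term with j = 0 is a^n C_r; the others have to vanish modulo the p-part
    of n^* p.  Give the coefficient c of t^i the weight 2 v_p(c) + floor(i / p),
    and let W_e be the polynomials all of whose coefficients have weight at
    least e.  Then:
    - T maps W_e to W_(e+1) ([twist_defect_filtration]).  By the Leibniz formula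
      T is multiplication by L^p 1 - a plus terms p g^(k) / k! times something,
      with 0 < k <= p; such a term gains 2 from the factor p and loses at most 1
      because k <= p.  The coefficients of t^i in L^p 1 - a are divisible by p
      for i < p: for i > 0 since the derivative of L^p 1 is 0 modulo p
      ([deriv_twist_power_prime]), and for i = 0 since C_p = a modulo p
      ([cycle_poly_prime_congr]).
    - g in W_e implies that (L^r g)(0) is divisible by p^(ceil(e/2))
      ([in_filtration_coef0]), because the coefficient of t^i in g enters
      multiplied by i! bin(r, i), and v_p(i!) >= floor(i / p).
    So the j-th term is divisible by bin(n, j) p^(ceil(j/2)), and
    v_p(bin(n, j)) >= v_p(n) - v_p(j) makes this a multiple of the p-part of
    n^* p ([dvdn_bin_nstar]).  The loss of a factor 2 in n^* comes from p = 2,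
    where ceil(j/2) can only be bounded below by v_2(j), as j = 2 shows.

    This congruence holds over the integers, and the prime-to-p part of n^* p
    is a unit of Z_p.  The statements about single coefficients are the case
    r = 0, read off monomial by monomial. *)

(** * Divisibility by a natural number in a commutative ring *)

Section NatMultiples.
Variable A : comNzRingType.
Implicit Types (d e : nat) (x y : A).

Definition nat_multiple d x := exists z, x = d%:R * z.

Lemma nat_multiple0 d : nat_multiple d 0.
Proof. by exists 0; rewrite mulr0. Qed.

Lemma nat_multipleD d x y :
  nat_multiple d x -> nat_multiple d y -> nat_multiple d (x + y).
Proof. by move=> [u ->] [v ->]; exists (u + v); rewrite mulrDr. Qed.

Lemma nat_multipleMl d x y : nat_multiple d y -> nat_multiple d (x * y).
Proof. by move=> [z ->]; exists (x * z); rewrite mulrCA. Qed.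

Lemma nat_multipleM d e x y :
  nat_multiple d x -> nat_multiple e y -> nat_multiple (d * e) (x * y).
Proof. by move=> [u ->] [v ->]; exists (u * v); rewrite natrM mulrACA. Qed.

Lemma nat_multiple_dvd d e x :
  (d %| e)%N -> nat_multiple e x -> nat_multiple d x.
Proof.
case/dvdnP=> q -> [z ->]; exists (q%:R * z).
by rewrite natrM mulrAC mulrC mulrA.
Qed.

Lemma nat_multiple_nat d e : (d %| e)%N -> nat_multiple d e%:R.
Proof. by move=> /nat_multiple_dvd; apply; exists 1; rewrite mulr1. Qed.

Lemma nat_multiple_sum (I : Type) (s : seq I) (P : pred I) d (F : I -> A) :
  (forall i, P i -> nat_multiple d (F i)) ->
  nat_multiple d (\sum_(i <- s | P i) F i).
Proof.
move=> dF; apply: (big_ind (nat_multiple d)) => //; first exact: nat_multiple0.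
exact: nat_multipleD.
Qed.

Lemma nat_multiple_cancel d e x :
  (0 < e)%N -> coprime e d -> nat_multiple d (e%:R * x) -> nat_multiple d x.
Proof.
move=> e_gt0 co_ed [z ez]; have [u v uE _] := egcdnP d e_gt0.
have -> : x = (u * e)%:R * x - (v * d)%:R * x.
  by rewrite uE (eqP co_ed) natrD mulrDl mul1r addrC addKr.
exists (u%:R * z - v%:R * x).
by rewrite !natrM -!mulrA ez mulrBr !(mulrCA d%:R).
Qed.

End NatMultiples.


(** * The operator g -> g' + f g and its powers *)

(** The binomial theorem for a sum of two commuting operators, with B i j in the
    place of the result of applying the first one i times and the second one j
    times.  It yields both the Leibniz formula and the expansion of (T + a)^n. *)
Lemma iter_binomial (M : zmodType) (L : M -> M) (B : nat -> nat -> M) :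
  zmod_morphism L -> (forall i j, L (B i j) = B i.+1 j + B i j.+1) ->
  forall n, iter n L (B 0 0)%N = \sum_(k < n.+1) B k (n - k)%N *+ 'C(n, k).
Proof.
move=> L_morph LB; pose Lm := GRing.isZmodMorphism.Build M M L L_morph.
pose La : {additive M -> M} := HB.pack L Lm.
have LS n (F : 'I_n -> M) : L (\sum_(k < n) F k) = \sum_(k < n) L (F k).
  exact: (raddf_sum La).
have LMn k x : L (x *+ k) = L x *+ k by exact: (raddfMn La).
elim=> [|n IHn]; first by rewrite big_ord1.
rewrite iterS IHn LS; under eq_bigr => k _ do rewrite LMn LB mulrnDl.
rewrite big_split /= [RHS]big_ord_recl /= bin0 subn0.
under [in RHS]eq_bigr => k _ do rewrite /bump /= add1n binS mulrnDr subSS.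
rewrite big_split /= addrA addrC; congr (_ + _).
rewrite big_ord_recl /= bin0 subn0.
rewrite [in RHS]big_ord_recr /= bin_small // mulr0n addr0.
congr (_ + _); apply: eq_bigr => k _; rewrite /bump /= add1n.
by rewrite subnSK.
Qed.

Section TwistedDerivation.
Variables (A : comNzRingType) (f : {poly A}).
Implicit Types g h : {poly A}.

Definition twist g : {poly A} := g^`() + f * g.

Lemma twistE g : twist g = g^`() + f * g. Proof. by []. Qed.

Fact twist_is_zmod_morphism : zmod_morphism twist.
Proof. by move=> g h; rewrite /twist derivB mulrBr opprD addrACA. Qed.

HB.instance Definition _ :=
  GRing.isZmodMorphism.Build {poly A} {poly A} twist twist_is_zmod_morphism.

Fact iter_twist_is_zmod_morphism n : zmod_morphism (iter n twist).
Proof. by elim: n => [|n IHn] g h //=; rewrite IHn raddfB. Qed.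

HB.instance Definition _ n :=
  GRing.isZmodMorphism.Build {poly A} {poly A} (iter n twist)
    (iter_twist_is_zmod_morphism n).

Lemma iter_twist_scale n c g : iter n twist (c%:P * g) = c%:P * iter n twist g.
Proof.
elim: n => //= n ->; rewrite /twist derivM derivC mul0r add0r mulrDr.
by rewrite mulrCA.
Qed.

Definition twist_power k : {poly A} := iter k twist 1.

Lemma twist1 : twist 1 = f.
Proof. by rewrite /twist derivC mulr1 add0r. Qed.

Lemma twist_Leibniz n g :
  iter n twist g = \sum_(k < n.+1) (g^`(k) * twist_power (n - k)) *+ 'C(n, k).
Proof.
pose B i j : {poly A} := g^`(i) * twist_power j.
have {1}-> : g = B 0%N 0%N by rewrite /B mulr1.
apply: (iter_binomial (B := B)); first exact: twist_is_zmod_morphism.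
move=> i j.
rewrite /B derivnS -[twist_power j.+1]/(twist (twist_power j)) !twistE derivM.
by rewrite -addrA (mulrCA f) -mulrDr.
Qed.

Lemma coef0_iter_twist n g :
  (iter n twist g)`_0 =
  \sum_(k < n.+1) g`_k * (twist_power (n - k))`_0 *+ (n ^_ k).
Proof.
rewrite twist_Leibniz coef_sum; apply: eq_bigr => k _.
rewrite coefMn coef0M coef_derivn addn0 ffactnn.
by rewrite mulrnAl -mulrnA -bin_ffact mulnC.
Qed.

Section Prime.
Variable p : nat.
Hypothesis p_prime : prime p.
Let p_gt0 := prime_gt0 p_prime.

Lemma coef_derivn_prime g i : nat_multiple p (g^`(p))`_i.
Proof.
rewrite nderivn_def coefMn -mulr_natl mulrC; apply: nat_multipleMl.
by apply: nat_multiple_nat; rewrite dvdn_fact // p_gt0 leqnn.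
Qed.

(** Since L 1 = f, the polynomial L^(p+1) 1 equals both L^p f and
    (L^p 1)' + f L^p 1.  The Leibniz formula for L^p f starts with f L^p 1, and
    its other terms contain a factor bin(p, k) with 0 < k < p or a p-th
    derivative. *)
Lemma deriv_twist_power_prime i : nat_multiple p ((twist_power p)^`())`_i.
Proof.
have -> : (twist_power p)^`() = iter p twist f - f * twist_power p.
  have -> : iter p twist f = twist (twist_power p).
    by rewrite -iterS iterSr twist1.
  by rewrite twistE addrK.
rewrite twist_Leibniz big_ord_recl bin0 subn0 derivn0 mulr1n addrC addKr.
rewrite coef_sum; apply: nat_multiple_sum => k _; rewrite lift0.
rewrite coefMn -mulr_natl; have [kp|] := ltnP k.+1 p.
  by rewrite mulrC; apply/nat_multipleMl/nat_multiple_nat/prime_dvd_bin.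
move=> pk; have -> : k.+1 = p by apply/eqP; rewrite eqn_leq pk ltn_ord.
rewrite subnn mulr1; apply: nat_multipleMl; exact: coef_derivn_prime.
Qed.

Lemma coef_twist_power_prime i :
  (0 < i < p)%N -> nat_multiple p (twist_power p)`_i.
Proof.
case: i => // i /andP[_ ip].
apply: (@nat_multiple_cancel _ _ i.+1) => //.
  by rewrite coprime_sym prime_coprime // gtnNdvd.
by rewrite mulr_natl -coef_deriv; exact: deriv_twist_power_prime.
Qed.

(** The coefficients of t^i have weight 2 v_p + floor(i / p) at least e. *)
Definition in_filtration e g :=
  forall i, nat_multiple (p ^ uphalf (e - i %/ p)) g`_i.

Lemma in_filtrationD e g h :
  in_filtration e g -> in_filtration e h -> in_filtration e (g + h).
Proof. by move=> Wg Wh i; rewrite coefD; apply: nat_multipleD. Qed.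

Lemma in_filtrationMl e g h : in_filtration e h -> in_filtration e (g * h).
Proof.
move=> Wh i; rewrite coefM; apply: nat_multiple_sum => k _.
apply: nat_multipleMl; apply: nat_multiple_dvd (Wh _).
by rewrite dvdn_exp2l // uphalf_leq // leq_sub2l // leq_div2r // leq_subr.
Qed.

(** Below degree p the factor p of g`_k gains weight 2; from degree p on, the
    shift of the degree gains weight 1. *)
Lemma in_filtration_multiplier e g h :
    (forall i, (i < p)%N -> nat_multiple p g`_i) ->
  in_filtration e h -> in_filtration e.+1 (g * h).
Proof.
move=> pg Wh i; rewrite coefM; apply: nat_multiple_sum => k _.
have [kp|pk] := ltnP k p.
  apply: nat_multiple_dvd (nat_multipleM (pg _ kp) (Wh _)).
  rewrite -expnS dvdn_exp2l //; have := leq_div2r p (leq_subr k i); lia.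
apply: nat_multipleMl; apply: nat_multiple_dvd (Wh _).
rewrite dvdn_exp2l //; have ki : (k <= i)%N by rewrite -ltnS.
have pi := leq_trans pk ki.
have := leq_div2r p (leq_sub2l i pk).
have := divnDr (i - p) (dvdnn p); rewrite subnK // divnn p_gt0; lia.
Qed.

(** The factor p gains weight 2, and lowering the degree by k <= p loses at
    most 1. *)
Lemma in_filtration_nderivn e k c g : (k <= p)%N ->
  in_filtration e g -> in_filtration e.+1 ((g^`N(k) * c) *+ p).
Proof.
move=> kp Wg; rewrite -mulrnAl mulrC; apply: in_filtrationMl => i.
rewrite coefMn coef_nderivn -mulr_natl -[g`_(k + i) *+ _]mulr_natl.
have pp : nat_multiple p (p%:R : A) by exact: nat_multiple_nat.
apply: nat_multiple_dvd (nat_multipleM pp (nat_multipleMl _ (Wg _))).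
rewrite -expnS dvdn_exp2l //; have := leq_div2r p (leq_add kp (leqnn i)).
by rewrite (divnDl i (dvdnn p)) divnn p_gt0; lia.
Qed.

Variable a : A.
Hypothesis a_congr : nat_multiple p ((twist_power p)`_0 - a).

Definition twist_defect g : {poly A} := iter p twist g - a%:P * g.

Lemma twist_defect_filtration e g :
  in_filtration e g -> in_filtration e.+1 (twist_defect g).
Proof.
move=> Wg; rewrite /twist_defect twist_Leibniz big_ord_recl bin0 subn0.
rewrite derivn0 mulr1n addrAC [g * _]mulrC -mulrBl.
apply: in_filtrationD.
  apply: in_filtration_multiplier => // i ip; rewrite coefB coefC.
  case: eqP => [-> // | /eqP i0]; rewrite subr0.
  by apply: coef_twist_power_prime; rewrite lt0n i0.
apply: (big_ind (in_filtration e.+1)) => [i|*|k _].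
- by rewrite coef0; exact: nat_multiple0.
- exact: in_filtrationD.
rewrite lift0 nderivn_def mulrnAl -mulrnA.
have /dvdnP[q ->] : (p %| (k.+1)`! * 'C(p, k.+1))%N.
  have [kp|pk] := ltnP k.+1 p; first by rewrite dvdn_mull ?prime_dvd_bin.
  by rewrite dvdn_mulr // dvdn_fact // p_gt0.
by rewrite mulrnA -mulrnAr; apply: in_filtration_nderivn Wg.
Qed.

Lemma iter_twist_defect_filtration j :
  in_filtration j (iter j twist_defect 1).
Proof.
elim: j => [|j IHj]; last exact: twist_defect_filtration.
by move=> i; rewrite sub0n; exists (1%:P)`_i; rewrite mul1r.
Qed.

Lemma expn_divn_dvd_fact k : (p ^ (k %/ p) %| k`!)%N.
Proof.
rewrite pfactor_dvdn ?fact_gt0 // logn_fact //.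
have [->|k_gt0] := posnP k; first by rewrite div0n.
by rewrite big_ltn // expn1 leq_addr.
Qed.

(** By [coef0_iter_twist] the coefficient of t^k is multiplied by the falling
    factorial of r, a multiple of k! and thus of p^(floor(k / p)). *)
Lemma in_filtration_coef0 e r g :
  in_filtration e g -> nat_multiple (p ^ uphalf e) (iter r twist g)`_0.
Proof.
move=> Wg; rewrite coef0_iter_twist; apply: nat_multiple_sum => k _.
rewrite -mulr_natr mulrAC mulrC; apply: nat_multipleMl.
have pk : nat_multiple (p ^ (k %/ p)) ((r ^_ k)%:R : A).
  apply: nat_multiple_nat; apply: dvdn_trans (expn_divn_dvd_fact k) _.
  by rewrite -bin_ffact dvdn_mull.
apply: nat_multiple_dvd (nat_multipleM (Wg k) pk).
by rewrite -expnD dvdn_exp2l //; move: (k %/ p)%N => q; lia.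
Qed.

Lemma coef0_iter_twist_prime n r :
  (iter (r + n * p) twist 1)`_0 = \sum_(j < n.+1)
    a ^+ (n - j) * (iter r twist (iter j twist_defect 1))`_0 *+ 'C(n, j).
Proof.
pose B i j : {poly A} := (a ^+ j)%:P * iter i twist_defect 1.
have LB i j : iter p twist (B i j) = B i.+1 j + B i j.+1.
  rewrite iter_twist_scale /B iterS /twist_defect exprSr polyCM.
  by rewrite -mulrA -mulrDr subrK.
have B00 : B 0%N 0%N = 1 by rewrite /B mulr1.
rewrite iterD iterM -{1}B00 (iter_binomial (B := B)) //;
  last exact: iter_twist_is_zmod_morphism.
rewrite raddf_sum coef_sum; apply: eq_bigr => j _.
by rewrite raddfMn coefMn -coefCM -iter_twist_scale.
Qed.

End Prime.
End TwistedDerivation.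

(** * Arithmetic of the modulus *)

Lemma nstar_gt0 n : (0 < n)%N -> (0 < nstar n)%N.
Proof. by rewrite /nstar; case: ifP; lia. Qed.

Lemma nstar_dvd n : (nstar n %| n)%N.
Proof.
rewrite /nstar; case: ifP => // n_even.
by rewrite -[X in (_ %| X)%N]odd_double_half n_even -mul2n dvdn_mull.
Qed.

Lemma logn_nstar_le p n : (0 < n)%N -> (logn p (nstar n) <= logn p n)%N.
Proof. by move=> n_gt0; apply: dvdn_leq_log => //; apply: nstar_dvd. Qed.

Lemma logn2_nstar_lt n : (0 < n)%N -> ~~ odd n ->
  (logn 2 (nstar n) < logn 2 n)%N.
Proof.
move=> n_gt0 n_even; rewrite /nstar (negPf n_even).
rewrite -[X in (_ < logn _ X)%N]odd_double_half (negPf n_even) -mul2n.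
by rewrite lognM //; lia.
Qed.

(** From j bin(n, j) = n bin(n-1, j-1), the claim reduces to
    v_p(j) + 1 <= ceil(j/2) for p odd, to v_2(j) <= ceil(j/2) for p = 2 and n
    even, and to 1 <= ceil(j/2) for p = 2 and n odd. *)
Lemma dvdn_bin_nstar p n j : prime p -> (0 < j <= n)%N ->
  ((nstar n * p)`_p %| 'C(n, j) * p ^ uphalf j)%N.
Proof.
move=> p_pr /andP[j_gt0 jn]; have n_gt0 := leq_trans j_gt0 jn.
have p_gt0 := prime_gt0 p_pr; have p_gt1 := prime_gt1 p_pr.
have C_gt0 : (0 < 'C(n, j))%N by rewrite bin_gt0.
rewrite p_part pfactor_dvdn ?muln_gt0 ?expn_gt0 ?C_gt0 ?p_gt0 //.
have lognp : logn p p = 1%N by rewrite logn_prime // eqxx.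
rewrite !lognM ?nstar_gt0 ?expn_gt0 ?p_gt0 // lognX lognp muln1.
have lognC : (logn p n <= logn p j + logn p 'C(n, j))%N.
  rewrite -lognM // -(prednK j_gt0) -mul_bin_diag dvdn_leq_log ?dvdn_mulr //.
  by rewrite muln_gt0 n_gt0 bin_gt0 -ltnS !prednK.
have : (p ^ logn p j <= j)%N by rewrite dvdn_leq // pfactor_dvdnn.
have := logn_nstar_le p n_gt0.
case: (ltngtP p 2) p_gt1 => // [p_gt2 _|p2 _].
  have : (2 * logn p j < p ^ logn p j)%N.
    elim: (logn p j) => // l IHl; rewrite expnS; nia.
  lia.
rewrite p2 in lognC *; have [n_odd|n_even] := boolP (odd n).
  have -> : logn 2 n = 0%N by rewrite lognE dvdn2 n_odd !andbF.
  lia.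
have := logn2_nstar_lt n_gt0 n_even.
have : (2 * logn 2 j <= (2 ^ logn 2 j).+1)%N.
  elim: (logn 2 j) => // [[|l]] // IHl.
  by have := expn_gt0 2 l; rewrite !expnS in IHl *; lia.
lia.
Qed.

Lemma twist_power_congr (A : comNzRingType) (f : {poly A}) (p n r : nat)
    (a : A) :
    prime p -> (0 < n)%N -> nat_multiple p ((twist_power f p)`_0 - a) ->
  nat_multiple (nstar n * p)`_p
    ((twist_power f (r + n * p))`_0 - a ^+ n * (twist_power f r)`_0).
Proof.
move=> p_pr n_gt0 a_congr; rewrite /twist_power (coef0_iter_twist_prime _ _ a).
rewrite big_ord_recl bin0 subn0 mulr1n addrC addKr.
apply: nat_multiple_sum => j _; rewrite lift0 -mulr_natl mulrCA.
apply: nat_multipleMl.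
have jn : (0 < j.+1 <= n)%N by rewrite ltn_ord.
apply: nat_multiple_dvd (dvdn_bin_nstar p_pr jn) _.
apply: nat_multipleM; first exact: nat_multiple_nat.
by apply: in_filtration_coef0 => //; apply: iter_twist_defect_filtration.
Qed.


(** * Units of the p-adic integers *)

Lemma padic_natr p n k : padic_proj (n%:R : padic_int p) k = n%:R.
Proof. by elim: n => // n IHn; rewrite !mulrS /= IHn. Qed.

Lemma padic_nat_unit p u : prime p -> coprime u p ->
  exists v : padic_int p, u%:R * v = 1.
Proof.
move=> p_pr co_up; have p_gt1 := prime_gt1 p_pr.
have u_unit k : (u%:R : 'Z_(p ^ k.+1)) \is a GRing.unit.
  by rewrite unitZpE ?coprimeXl 1?coprime_sym // -[1%N](expn0 p) ltn_exp2l.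
have v_compat k : Zpow_red (u%:R^-1 : 'Z_(p ^ k.+2)) = u%:R^-1.
  apply: (mulrI (u_unit k)); rewrite (divrr (u_unit k)).
  have {1}-> : (u%:R : 'Z_(p ^ k.+1)) = Zpow_red (u%:R : 'Z_(p ^ k.+2)).
    elim: u {co_up u_unit} => [|u IHu]; first by rewrite Zpow_red0.
    by rewrite !mulrS Zpow_redD -IHu; congr (_ + _).
  by rewrite -Zpow_redM (divrr (u_unit k.+1)) Zpow_red1.
exists (PadicInt v_compat); apply: padic_intP => k /=.
by rewrite padic_natr (divrr (u_unit k)).
Qed.

(** The prime-to-p part of d is invertible in every algebra over Z_p. *)
Lemma congr_mod_padic p d (R : comNzRingType)
    (h : {rmorphism padic_int p -> R}) (x y : R) :
    prime p -> (0 < d)%N ->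
  nat_multiple d`_p (x - y) -> congr_mod d%:R x y.
Proof.
move=> p_pr d_gt0 [z xy].
have [v uv] : exists v : padic_int p, (d`_p^')%:R * v = 1.
  apply: padic_nat_unit => //; rewrite coprime_sym prime_coprime //.
  by rewrite -p'natE // part_pnat.
exists (h v * z); rewrite xy -[in RHS](partnC p d_gt0) natrM -mulrA.
congr (_ * _).
by rewrite mulrA -(rmorph_nat h d`_p^') -rmorphM uv rmorph1 mul1r.
Qed.

(** * Cycle indicators as constant terms *)

Section CycleType.
Variable N : nat.
Implicit Types (m : 'X_{1..N}) (i j : 'I_N).

Lemma cycle_weight_bigD1 (m : 'I_N -> nat) i :
  cycle_weight m = (i.+1 * m i + \sum_(j < N | j != i) j.+1 * m j)%N.
Proof. by rewrite /cycle_weight (bigD1 i). Qed.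

Lemma cycle_weight_ge (m : 'I_N -> nat) i : (i.+1 * m i <= cycle_weight m)%N.
Proof. by rewrite (cycle_weight_bigD1 m i) leq_addr. Qed.

Lemma mnm_of_weight m i :
  cycle_weight m = (i.+1 * m i)%N -> m = (U_(i) *+ m i)%MM.
Proof.
move/eqP; rewrite (cycle_weight_bigD1 m i) -[X in _ == X]addn0 eqn_add2l.
rewrite sum_nat_eq0 => /forallP m0; apply/mnmP => j.
rewrite mulmnE mnm1E; have [<-|ij] := eqVneq i j; first by rewrite mul1n.
by have /implyP := m0 j; rewrite eq_sym ij muln_eq0 /= mul0n => /(_ isT)/eqP.
Qed.

Lemma cycle_weightDU m i :
  cycle_weight (m + U_(i))%MM = (cycle_weight m + i.+1)%N.
Proof.
rewrite !(cycle_weight_bigD1 _ i) mnmDE mnm1E eqxx mulnDr muln1 addnAC.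
congr (_ + _ + _)%N; apply: eq_bigr => j ji.
by rewrite mnmDE mnm1E eq_sym (negPf ji) addn0.
Qed.

Lemma cycle_denDU m i :
  cycle_den (m + U_(i))%MM = (cycle_den m * (i.+1 * (m i).+1))%N.
Proof.
rewrite /cycle_den !(bigD1 (P := xpredT) i) //= mnmDE mnm1E eqxx addn1.
rewrite factS expnS (eq_bigr (fun j : 'I_N => j.+1 ^ m j * (m j)`!)%N).
  by ring.
by move=> j ji; rewrite mnmDE mnm1E eq_sym (negPf ji) addn0.
Qed.

Lemma cycle_den0 : cycle_den (0%MM : 'X_{1..N}) = 1%N.
Proof. by rewrite /cycle_den big1 // => i _; rewrite mnm0E. Qed.

Lemma cycle_weight0 : cycle_weight (0%MM : 'X_{1..N}) = 0%N.
Proof. by rewrite /cycle_weight big1 // => i _; rewrite mnm0E muln0. Qed.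

Lemma cycle_weight_eq0 m : (cycle_weight m == 0)%N = (m == 0%MM).
Proof.
apply/eqP/eqP => [|->]; last exact: cycle_weight0.
move=> m0; apply/mnmP => i; rewrite mnm0E.
by have := cycle_weight_ge m i; rewrite m0 leqn0 => /eqP; lia.
Qed.

Lemma cycle_den_gt0 m : (0 < cycle_den m)%N.
Proof. by rewrite prodn_gt0 // => i; rewrite muln_gt0 expn_gt0 fact_gt0. Qed.

Lemma cycle_denMU i k : cycle_den (U_(i) *+ k)%MM = (i.+1 ^ k * k`!)%N.
Proof.
elim: k => [|k IHk]; first by rewrite mulm0n cycle_den0.
rewrite mulmS addmC cycle_denDU IHk mulmnE mnm1E eqxx mul1n expnS factS.
ring.
Qed.

Lemma mcoeffMU (R : nzRingType) (q : {mpoly R[N]}) m i :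
  (q * 'X_i)@_m = if m i is 0 then 0 else q@_(m - U_(i)).
Proof.
have [mi0|mi_gt0] := posnP (m i); last first.
  have Um : (U_(i) <= m)%MM by rewrite lep1mP -lt0n.
  by rewrite -[in LHS](submK Um) addmC mcoeffMX; case: (m i) mi_gt0.
rewrite mi0; apply/eqP; rewrite mcoeff_eq0 (perm_mem (msuppMX _ _)).
by apply/mapP => -[m' _ m_def]; rewrite m_def mnmDE mnm1E eqxx in mi0.
Qed.

(** The logarithmic derivative of the exponential generating function of the
    cycle indicators.  If X_i is read as the i-th power sum, this is the
    generating function of the power sums. *)
Definition power_sums : {poly {mpoly int[N]}} := \sum_(i < N) 'X_i *: 'X^i.

Definition cycle_poly k : {mpoly int[N]} := (twist_power power_sums k)`_0.

Lemma cycle_poly0 : cycle_poly 0 = 1.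
Proof. by rewrite /cycle_poly coefC. Qed.

Lemma cycle_polyS k :
  cycle_poly k.+1 = \sum_(i < N) cycle_poly (k - i) * 'X_i *+ (k ^_ i).
Proof.
rewrite /cycle_poly {1}/twist_power iterSr twist1.
have -> : iter k (twist power_sums) power_sums
    = \sum_(i < N) iter k (twist power_sums) (('X_i)%:P * 'X^i).
  rewrite -raddf_sum; congr (iter _ _ _); apply: eq_bigr => i _.
  by rewrite mul_polyC.
rewrite coef_sum; apply: eq_bigr => i _.
rewrite iter_twist_scale coefCM coef0_iter_twist.
have [ik|ki] := leqP i k; last first.
  rewrite ffact_small // mulr0n big1 ?mulr0 // => j _; rewrite coefXn.
  by case: eqP => [ji|_]; rewrite ?mul0r ?mul0rn //; have := ltn_ord j; lia.
have ik1 : (i < k.+1)%N by [].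
rewrite (bigD1 (Ordinal ik1)) //= coefXn eqxx mul1r big1 ?addr0 => [|j ji].
  by rewrite mulrnAr mulrC.
rewrite coefXn; case: eqP => [ij|_]; last by rewrite mul0r mul0rn.
by case/eqP: ji; apply: val_inj.
Qed.

(** Cross-multiplied form of c_k(m) = k! / den(m).  In the recurrence
    [cycle_polyS] the variable X_(i+1) contributes
    k! (i+1) m_i / den(m), and the sum of the (i+1) m_i is k + 1. *)
Lemma mcoeff_cycle_poly k m :
  (cycle_poly k)@_m * (cycle_den m)%:R = (k`! * (cycle_weight m == k))%:R.
Proof.
elim/ltn_ind: k m => -[|k] IHk m.
  rewrite cycle_poly0 mcoeff1 cycle_weight_eq0 mul1n.
  by case: eqP => [->|_]; rewrite ?mul0r // cycle_den0 mulr1.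
have coefE i : (cycle_poly (k - i) * 'X_i *+ (k ^_ i))@_m * (cycle_den m)%:R
    = (k`! * (cycle_weight m == k.+1) * (i.+1 * m i))%:R :> int.
  rewrite mcoeffMn mcoeffMU; case mi: (m i) => [|c].
    by rewrite mul0rn mul0r !muln0.
  have mE : m = (m - U_(i) + U_(i))%MM by rewrite submK // lep1mP mi.
  have m'i : (m - U_(i))%MM i = c by rewrite mnmBE mnm1E eqxx mi subn1.
  move: (m - U_(i))%MM m'i mE => m' m'i ->.
  rewrite cycle_denDU cycle_weightDU m'i [X in _ * X]natrM mulrA.
  rewrite mulrnAl IHk ?ltnS ?leq_subr // -mulrnA -natrM.
  congr (_%:R); have [ik|ki] := leqP i k.
    rewrite -(ffact_fact ik).
    have -> : (cycle_weight m' + i.+1 == k.+1)%N = (cycle_weight m' == k - i)%N.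
      lia.
    ring.
  have -> : (cycle_weight m' + i.+1 == k.+1)%N = false by lia.
  by rewrite ffact_small // !muln0 !mul0n.
rewrite cycle_polyS raddf_sum mulr_suml (eq_bigr _ (fun i _ => coefE i)).
rewrite -natr_sum -big_distrr /= -/(cycle_weight m) factS.
by congr (_%:R); case: eqP => [->|_]; rewrite ?muln0 ?mul0n // !muln1 mulnC.
Qed.

Lemma mcoeff_cycle_poly_coef m :
  cycle_weight m = N -> (cycle_poly N)@_m = (cycle_coef m)%:R.
Proof.
move=> mN; have den_neq0 : (cycle_den m)%:R != 0 :> int.
  by rewrite Num.Theory.pnatr_eq0 -lt0n cycle_den_gt0.
apply: (mulIf den_neq0); rewrite mcoeff_cycle_poly mN eqxx muln1 -natrM.
by rewrite divnK // cycle_den_dvd.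
Qed.

End CycleType.

(** * Comparison with the cycle indicators in their own variables *)

Section Widening.
Variables (k N : nat) (le_kN : (k <= N)%N).
Implicit Types (m : 'I_k -> nat) (M : 'X_{1..N}).

Let w := widen_ord le_kN.

Definition mnm_widen m : 'X_{1..N} := (\sum_(i < k) U_(w i) *+ m i)%MM.

Lemma mnm_widenE m i : mnm_widen m (w i) = m i.
Proof.
rewrite mnm_sumE (bigD1 i) //= mulmnE mnm1E eqxx mul1n big1 ?addn0 // => j ji.
by rewrite mulmnE mnm1E -val_eqE /= val_eqE (negPf ji) mul0n.
Qed.

Lemma mnm_widen_high m (j : 'I_N) : (k <= j)%N -> mnm_widen m j = 0%N.
Proof.
move=> kj; rewrite mnm_sumE big1 // => i _; rewrite mulmnE mnm1E -val_eqE /=.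
by have := ltn_ord i; case: eqP => [->|_] //; lia.
Qed.

Lemma mnm_widenP m M : (forall i, M (w i) = m i) ->
  (forall j : 'I_N, (k <= j)%N -> M j = 0%N) -> mnm_widen m = M.
Proof.
move=> Mw M0; apply/mnmP => j; have [kj|jk] := leqP k j.
  by rewrite mnm_widen_high // M0.
have -> : j = w (Ordinal jk) by apply: val_inj.
by rewrite mnm_widenE Mw.
Qed.

Lemma cycle_weight_widen m : cycle_weight (mnm_widen m) = cycle_weight m.
Proof.
rewrite /cycle_weight (bigID (fun j : 'I_N => (j < k)%N)) /=
  (big_ord_narrow le_kN).
rewrite [X in (_ + X)%N]big1 ?addn0 => [|j]; last first.
  by rewrite -leqNgt => kj; rewrite mnm_widen_high // muln0.
by apply: eq_bigr => i _; rewrite mnm_widenE.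
Qed.

Lemma cycle_den_widen m : cycle_den (mnm_widen m) = cycle_den m.
Proof.
rewrite /cycle_den (bigID (fun j : 'I_N => (j < k)%N)) /=
  (big_ord_narrow le_kN).
rewrite [X in (_ * X)%N]big1 ?muln1 => [|j]; last first.
  by rewrite -leqNgt => kj; rewrite mnm_widen_high.
by apply: eq_bigr => i _; rewrite mnm_widenE.
Qed.

Lemma cycle_indicator_inE (R : comNzRingType) :
  cycle_indicator_in R le_kN =
  \sum_(m : {ffun 'I_k -> 'I_k.+1} | cycle_weight (fun i => m i) == k)
    (cycle_coef (fun i => m i))%:R *: 'X_[mnm_widen (fun i => m i)].
Proof.
rewrite /cycle_indicator_in /cycle_indicator (rmorph_sum (map_mpoly intr)).
rewrite raddf_sum /=; apply: eq_bigr => m _.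
have -> : \prod_(i < k) 'X_i ^+ m i
    = 'X_[[multinom (m i : nat) | i < k]] :> {mpoly int[k]}.
  by rewrite mpolyXE_id; apply: eq_bigr => i _; rewrite mnmE.
rewrite map_mpolyZ map_mpolyX /= comp_mpolyZ comp_mpolyX rmorph_nat.
congr (_ *: _); rewrite -mprodXnE; apply: eq_bigr => i _.
by rewrite mnmE tnth_mktuple.
Qed.

Lemma mcoeff_cycle_poly_sum M : (cycle_poly N k)@_M =
  \sum_(m : {ffun 'I_k -> 'I_k.+1} | cycle_weight (fun i => m i) == k)
    (cycle_coef (fun i => m i) * (mnm_widen (fun i => m i) == M))%:R.
Proof.
have den_neq0 : (cycle_den M)%:R != 0 :> int.
  by rewrite Num.Theory.pnatr_eq0 -lt0n cycle_den_gt0.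
apply: (mulIf den_neq0); rewrite mcoeff_cycle_poly.
have [Mk|Mk] := eqVneq (cycle_weight M) k; last first.
  rewrite muln0 big1 ?mul0r // => m /eqP mk.
  case: eqP => [mM|_]; rewrite ?muln0 //.
  by case/eqP: Mk; rewrite -mM cycle_weight_widen.
have M_le (j : 'I_N) : (j.+1 * M j <= k)%N.
  by rewrite -[X in (_ <= X)%N]Mk cycle_weight_ge.
have M0 (j : 'I_N) : (k <= j)%N -> M j = 0%N by have := M_le j; nia.
pose m0 : {ffun 'I_k -> 'I_k.+1} := [ffun i => inord (M (w i))].
have m0E i : m0 i = M (w i) :> nat.
  by rewrite ffunE inordK // ltnS; have := M_le (w i); nia.
have m0M : mnm_widen (fun i => m0 i) = M by apply: mnm_widenP.
have m0k : cycle_weight (fun i => m0 i) = k by rewrite -cycle_weight_widen m0M.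
rewrite (bigD1 m0) ?m0k //= m0M eqxx big1 => [|m /andP[_ mm0]]; last first.
  case: eqP => [mM|_]; rewrite ?muln0 //; case/eqP: mm0.
  by apply/ffunP => i; apply: val_inj; rewrite /= m0E -mM mnm_widenE.
rewrite addr0 !muln1 -natrM -m0M cycle_den_widen /cycle_coef divnK //.
exact: cycle_den_dvd.
Qed.

Lemma cycle_indicator_in_poly (R : comNzRingType) :
  cycle_indicator_in R le_kN = map_mpoly intr (cycle_poly N k).
Proof.
rewrite cycle_indicator_inE; apply/mpolyP => M.
rewrite mcoeff_map_mpoly mcoeff_cycle_poly_sum !raddf_sum /=.
apply: eq_bigr => m _.
by rewrite mcoeffZ mcoeffX -natrM /= rmorph_nat.
Qed.

End Widening.

Lemma cycle_indicator_poly (R : comNzRingType) N :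
  map_mpoly intr (cycle_indicator N) =
  map_mpoly intr (cycle_poly N N) :> {mpoly R[N]}.
Proof.
rewrite -(cycle_indicator_in_poly (leqnn N)) /cycle_indicator_in.
rewrite -[LHS]comp_mpoly_id; congr (_ \mPo _).
Qed.

Lemma nat_multiple_mpoly N d (q : {mpoly int[N]}) :
  (forall m, nat_multiple d q@_m) -> nat_multiple d q.
Proof.
move=> dq; rewrite [q]mpolyE; apply: nat_multiple_sum => m _.
have [z ->] := dq m; exists (z *: 'X_[m]).
by rewrite -scalerA scaler_nat mulr_natl.
Qed.

Lemma coprime_fact p n : prime p -> (n < p)%N -> coprime n`! p.
Proof.
move=> p_pr; elim: n => [|n IHn] np; first exact: coprime1n.
rewrite factS coprimeMl IHn ?(ltnW np) // andbT coprime_sym prime_coprime //.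
by rewrite gtnNdvd.
Qed.

(** * The congruence over the integers *)

Section PrimeBlocks.
Variables (p N : nat) (i1 ip : 'I_N).
Hypotheses (p_pr : prime p) (i1E : i1.+1 = 1%N) (ipE : ip.+1 = p).

Let p_gt1 := prime_gt1 p_pr.

Lemma fixed_neq_prime : i1 != ip.
Proof. by apply/eqP => i1p; have := p_gt1; rewrite -ipE -i1p i1E. Qed.

Definition prime_block : {mpoly int[N]} := 'X_i1 ^+ p - 'X_ip.

(** A factor p of some (i+1)^(m_i) or m_i! forces (i+1) m_i >= p, so that the
    whole weight sits at i + 1 = p or at i + 1 = 1. *)
Lemma coprime_cycle_den (m : 'X_{1..N}) : cycle_weight m = p ->
  m != (U_(i1) *+ p)%MM -> m != U_(ip)%MM -> coprime (cycle_den m) p.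
Proof.
move=> mp m1 mq; apply: (big_ind (fun d => coprime d p)) => [|d e cd ce|i _].
- exact: coprime1n.
- by rewrite coprimeMl cd.
have m_le : (i.+1 * m i <= p)%N by rewrite -[X in (_ <= X)%N]mp cycle_weight_ge.
have m_eq : (i.+1 * m i)%N = p -> m = (U_(i) *+ m i)%MM.
  by move=> im; apply: mnm_of_weight; rewrite im.
rewrite coprimeMl; apply/andP; split.
  have [-> //|mi_gt0] := posnP (m i); first exact: coprime1n.
  apply: coprimeXl; rewrite coprime_sym prime_coprime // gtnNdvd //.
  rewrite ltn_neqAle; apply/andP; split; last by nia.
  apply: contra mq => /eqP ip'; have mi : m i = 1%N by nia.
  rewrite [m]m_eq ?ip' ?mi ?muln1 //; apply/eqP; congr U_(_)%MM.
  by apply: val_inj; apply/eqP; rewrite -eqSS ip' ipE.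
apply: coprime_fact => //; rewrite ltnNge; apply: contra m1 => pm.
have i0 : i = i1 by apply: val_inj; move: i1E; rewrite /=; nia.
have mi : m i = p by rewrite i0 i1E in m_le pm *; lia.
by rewrite [m in m == _]m_eq mi i0 // i1E mul1n.
Qed.

(** X_1^p has coefficient 1, X_p has coefficient (p-1)! = -1 modulo p by
    Wilson, and all other coefficients p! / den(m) are multiples of p. *)
Lemma cycle_poly_prime_congr :
  nat_multiple p (cycle_poly N p - prime_block).
Proof.
apply: nat_multiple_mpoly => m; have cm := mcoeff_cycle_poly p m.
rewrite /prime_block !mcoeffB mcoeffXn mcoeffX.
have wE i c : cycle_weight (U_(i) *+ c)%MM = (i.+1 * c)%N.
  elim: c => [|c IHc]; first by rewrite mulm0n cycle_weight0 muln0.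
  by rewrite mulmS addmC cycle_weightDU IHc mulnS addnC.
have U1p : (U_(ip) == U_(i1) *+ p)%MM = false.
  apply/eqP => /mnmP/(_ ip).
  by rewrite mulmnE !mnm1E eqxx (negPf fixed_neq_prime).
have [m1|m1] := eqVneq m (U_(i1) *+ p)%MM.
  move: cm; rewrite m1 U1p cycle_denMU wE i1E mul1n eqxx exp1n mul1n muln1.
  rewrite -[X in _ = X]mul1r => /mulIf ->.
    by rewrite !subrr; exact: nat_multiple0.
  by rewrite Num.Theory.pnatr_eq0 -lt0n fact_gt0.
have [mp|mp] := eqVneq m U_(ip)%MM.
  move: cm; rewrite mp -[U_(ip)%MM]mulm1n cycle_denMU wE ipE !muln1 eqxx muln1.
  rewrite -[in p`!](prednK (prime_gt0 p_pr)) factS (prednK (prime_gt0 p_pr)).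
  rewrite [X in _ = X]natrM mulrC => /mulfI -> //; last first.
    by rewrite Num.Theory.pnatr_eq0 -lt0n prime_gt0.
  rewrite sub0r opprK natr1; apply: nat_multiple_nat.
  by rewrite -Wilson.
rewrite !subr0.
have [mw|mw] := eqVneq (cycle_weight m) p.
  apply: (nat_multiple_cancel (cycle_den_gt0 m)).
    exact: coprime_cycle_den.
  rewrite mulrC cm mw eqxx muln1; apply: nat_multiple_nat.
  by rewrite dvdn_fact // prime_gt0 /=.
move: cm; rewrite (negPf mw) muln0 => /eqP; rewrite mulf_eq0 => /orP[/eqP->|].
  exact: nat_multiple0.
by rewrite Num.Theory.pnatr_eq0 eqn0Ngt cycle_den_gt0.
Qed.

Lemma mcoeff_prime_blockX n (m : 'X_{1..N}) :
  (prime_block ^+ n)@_m =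
  (-1) ^+ m ip *
  ((m == (U_(i1) *+ (p * (n - m ip)) + U_(ip) *+ m ip)%MM) * 'C(n, m ip))%:R.
Proof.
have coefE (j : nat) :
    (('X_i1 ^+ p) ^+ (n - j) * 'X_ip ^+ j : {mpoly int[N]})@_m
     = (m == (U_(i1) *+ (p * (n - j)) + U_(ip) *+ j)%MM)%:R.
  by rewrite -exprM !mpolyXn -mpolyXD mcoeffX eq_sym.
have at_ip j c : (U_(i1) *+ c + U_(ip) *+ j)%MM ip = j.
  by rewrite mnmDE !mulmnE !mnm1E eqxx (negPf fixed_neq_prime) mul1n.
rewrite /prime_block exprBn raddf_sum /=.
have [mn|nm] := leqP (m ip) n; last first.
  rewrite bin_small // muln0 mulr0 big1 // => j _.
  rewrite mcoeffMn -mulrA -(rmorph_sign (@mpolyC N int)) mcoeffCM coefE.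
  case: eqP => [mj|_]; last by rewrite mulr0 mul0rn.
  by move: nm; rewrite mj at_ip; have := ltn_ord j; lia.
have mn1 : (m ip < n.+1)%N by [].
rewrite (bigD1 (Ordinal mn1)) //= big1 => [|j jm].
  rewrite addr0 mcoeffMn -mulrA -(rmorph_sign (@mpolyC N int)) mcoeffCM coefE.
  by rewrite -mulrnAr -mulrnA.
rewrite mcoeffMn -mulrA -(rmorph_sign (@mpolyC N int)) mcoeffCM coefE.
case: eqP => [mj|_]; last by rewrite mulr0 mul0rn.
by case/eqP: jm; apply: val_inj; rewrite /= mj at_ip.
Qed.

Lemma cycle_poly_congr n r : (0 < n)%N ->
  nat_multiple (nstar n * p)`_p
    (cycle_poly N (r + n * p) - prime_block ^+ n * cycle_poly N r).
Proof.
by move=> n_gt0; apply: twist_power_congr => //; apply: cycle_poly_prime_congr.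
Qed.

End PrimeBlocks.

(** Only p = 2 and q odd needs an argument: the difference is then 2 bin(n, q)
    up to sign, and bin(n, q) is divisible by the 2-part of n. *)
Lemma sign_prime_bin p n q : prime p -> (0 < n)%N ->
  nat_multiple (nstar n * p)`_p
    ((-1) ^+ q * 'C(n, q)%:R - (-1) ^+ (p * q) * 'C(n, q)%:R : int).
Proof.
move=> p_pr n_gt0; rewrite -mulrBl -[(-1) ^+ (p * q)]signr_odd oddM.
rewrite -[(-1) ^+ q]signr_odd; case: (even_prime p_pr) => [->|->]; last first.
  by rewrite subrr mul0r; exact: nat_multiple0.
case: (boolP (odd q)) => [q_odd|_]; last first.
  by rewrite subrr mul0r; exact: nat_multiple0.
have -> : ((-1) ^+ true - (-1) ^+ (odd 2 && true)) * 'C(n, q)%:R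
    = - 1 * ('C(n, q) * 2)%:R :> int.
  by rewrite natrM /=; ring.
apply/nat_multipleMl/nat_multiple_nat.
have q_gt0 : (0 < q)%N by apply: odd_gt0.
have n2C : (n`_2 %| 'C(n, q))%N.
  rewrite -(@Gauss_dvdr _ q); last first.
    by rewrite p_part coprimeXl // coprime2n.
  rewrite -(prednK q_gt0) -mul_bin_diag; apply: dvdn_mulr; exact: dvdn_part.
have n2_gt0 : (0 < n * 2)%N by rewrite muln_gt0 n_gt0.
apply: dvdn_trans (partn_dvd _ n2_gt0 (dvdn_mul (nstar_dvd n) (dvdnn 2))) _.
by rewrite partnM //; apply: dvdn_mul => //; apply: dvdn_part.
Qed.

Lemma nat_multiple_rmorph (A B : comNzRingType) (h : {rmorphism A -> B}) d x :
  nat_multiple d x -> nat_multiple d (h x).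
Proof. by case=> z ->; exists (h z); rewrite rmorphM rmorph_nat. Qed.

Lemma nat_multiple_mcoeff N d (q : {mpoly int[N]}) m :
  nat_multiple d q -> nat_multiple d q@_m.
Proof.
by case=> z ->; exists z@_m; rewrite !mulr_natl mcoeffMn.
Qed.

(** The exponents of the monomials of (X_1^p - X_p)^n are exactly those of weight
    np supported on the cycle lengths 1 and p. *)
Lemma cycle_coef_congr p n (m : 'I_(n * p) -> nat) (i1 ip : 'I_(n * p)) :
    prime p -> (0 < n)%N -> cycle_weight m = (n * p)%N ->
    i1.+1 = 1%N -> ip.+1 = p ->
  nat_multiple (nstar n * p)`_p ((cycle_coef m)%:R - (-1) ^+ m ip *
    ((\sum_(i < n * p | i.+1 \notin [:: 1; p]) m i == 0)%N * 'C(n, m ip))%:R : int).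
Proof.
move=> p_pr n_gt0 m_weight i1E ipE; set M := [multinom m i | i < n * p].
have M_fun : (M : 'I_(n * p) -> nat) = m.
  by apply: boolp.funext => i; rewrite mnmE.
have := nat_multiple_mcoeff M (cycle_poly_congr p_pr i1E ipE 0 n_gt0).
rewrite cycle_poly0 mulr1 mcoeffB add0n mcoeff_cycle_poly_coef M_fun //.
rewrite (mcoeff_prime_blockX p_pr i1E ipE) M_fun.
have i1p := fixed_neq_prime p_pr i1E ipE.
have notin_block (i : 'I_(n * p)) : (i.+1 \notin [:: 1; p])%N
    = (i != i1) && (i != ip).
  have eqi (a b : 'I_(n * p)) : (a == b) = (a.+1 == b.+1)%N by rewrite eqSS.
  by rewrite !inE negb_or !eqi i1E ipE.
suff -> : (M == (U_(i1) *+ (p * (n - m ip)) + U_(ip) *+ m ip)%MM)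
    = (\sum_(i < n * p | i.+1 \notin [:: 1; p]) m i == 0)%N by [].
apply/eqP/idP => [M_eq|].
  rewrite sum_nat_eq0; apply/forallP => i; apply/implyP.
  rewrite notin_block => /andP[/negPf i_1 /negPf i_p].
  by rewrite -M_fun M_eq mnmDE !mulmnE !mnm1E ![_ == i]eq_sym i_1 i_p.
rewrite sum_nat_eq0 => /forallP m0.
have {}m0 i : i != i1 -> i != ip -> m i = 0%N.
  by move=> i_1 i_p; apply/eqP/(implyP (m0 i)); rewrite notin_block i_1.
have w_eq : (n * p = m i1 + p * m ip)%N.
  rewrite -[LHS]m_weight /cycle_weight (bigD1 i1) //= (bigD1 ip) 1?eq_sym //=.
  rewrite big1 => [|i /andP[i_1 i_p]]; last by rewrite m0 ?muln0.
  by rewrite i1E ipE mul1n addn0.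
apply/mnmP => i; rewrite M_fun mnmDE !mulmnE !mnm1E.
have [->|i_1] := eqVneq i i1.
  rewrite eq_sym (negPf i1p) mul1n mul0n addn0 mulnBr.
  by rewrite [(p * n)%N]mulnC w_eq addnK.
have [->|i_p] := eqVneq i ip; first by rewrite mul1n.
by rewrite m0.
Qed.

Theorem mainTheorem1 (p n r : nat) (hp : prime p) (hn : (0 < n)%N)
    (m : 'I_(n * p) -> nat) (m_le : forall i, (m i <= n * p)%N)
    (m_weight : (n * p = \sum_(i < n * p) i.+1 * m i)%N)
    (i1 ip : 'I_(n * p)) (hi1 : i1.+1 = 1%N) (hip : ip.+1 = p) :
  [/\ (\sum_(i < n * p | i.+1 \notin [:: 1; p]) m i = 0)%N ->
        congr_mod ((nstar n * p)%:R : padic_int p)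
          (cycle_coef m)%:R ((-1) ^+ (p * m ip) * 'C(n, m ip)%:R),
      (\sum_(i < n * p | i.+1 \notin [:: 1; p]) m i <> 0)%N ->
        congr_mod ((nstar n * p)%:R : padic_int p) (cycle_coef m)%:R 0
    & congr_mod ((nstar n * p)%:R : {mpoly (padic_int p)[r + n * p]})
        (map_mpoly intr (cycle_indicator (r + n * p)))
        (('X_(widen_ord (leq_addl r (n * p)) i1) ^+ p
            - 'X_(widen_ord (leq_addl r (n * p)) ip)) ^+ n
         * cycle_indicator_in (padic_int p) (leq_addr (n * p) r))].
Proof.
have d_gt0 : (0 < nstar n * p)%N by rewrite muln_gt0 nstar_gt0 // prime_gt0.
have := cycle_coef_congr hp hn (esym m_weight) hi1 hip.
set S := bigop _ _ _ => cm.
split=> [S0|/eqP/negPf S0|].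
- apply: (congr_mod_padic idfun) => //.
  rewrite S0 eqxx mul1n in cm.
  have := nat_multipleD cm (sign_prime_bin (m ip) hp hn); rewrite subrKA.
  move/(nat_multiple_rmorph (intr : {rmorphism int -> padic_int p})).
  by rewrite rmorphB rmorphM !rmorph_nat rmorph_sign.
- apply: (congr_mod_padic idfun) => //.
  rewrite S0 mul0n mulr0 in cm.
  move/(nat_multiple_rmorph (intr : {rmorphism int -> padic_int p})): cm.
  by rewrite rmorphB rmorph0 !rmorph_nat.
apply: (congr_mod_padic (@mpolyC (r + n * p) (padic_int p))) => //.
set j1 := widen_ord _ i1; set jp := widen_ord _ ip.
have := cycle_poly_congr (i1 := j1) (ip := jp) hp hi1 hip r hn.
move/(nat_multiple_rmorph (map_mpoly (R := int) (S := padic_int p) intr)).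
rewrite /prime_block rmorphB rmorphM rmorphXn rmorphB rmorphXn /=.
by rewrite !map_mpolyX cycle_indicator_poly cycle_indicator_in_poly.
Qed.
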